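(* Let $i\in\{1,2\}$ and let $P$, $Q$ be problems with $P\leq_2 Q$. Then $\operatorname{Lev}^i(P)\leq\operatorname{Lev}^i(Q)$.
   Context: A partial function $F:\subseteq X\to Y$ is continuous if continuous on $\operatorname{dom}(F)$ with the subspace topology. A problem $P:\underline{X}\to\underline{Y}$ is a set of partial functions. For problems $P:\underline{X}_1\to\underline{Y}_1$, $Q:\underline{X}_2\to\underline{Y}_2$, $P\leq_2 Q$ means there are continuous partial $F:\subseteq\underline{X}_1\times\underline{Y}_2\to\underline{Y}_1$, $G:\subseteq\underline{X}_1\to\underline{X}_2$ with $(x\mapsto F(x,g(G(x))))\in P$ for all $g\in Q$. For a function $f:\underline{X}\to\underline{Y}$ (a partial function is treated as a function on its domain with the subspace topology) define by transfinite recursion: $\mathcal{L}^1_0(f)=X$, $\mathcal{L}^1_{\alpha+1}(f)=\{x\in\mathcal{L}^1_\alpha(f)\mid f|_{\mathcal{L}^1_\alpha(f)}\text{ is discontinuous at }x\}$, $\mathcal{L}^1_\gamma(f)=\bigcap_{\alpha<\gamma}\mathcal{L}^1_\alpha(f)$ for limit $\gamma$; and $\mathcal{L}^2_0(f)=X$, $\mathcal{L}^2_{\alpha+1}(f)=cl\{x\in\mathcal{L}^2_\alpha(f)\mid f|_{\mathcal{L}^2_\alpha(f)}\text{ is discontinuous at }x\}$, $\mathcal{L}^2_\gamma(f)=cl\bigcap_{\alpha<\gamma}\mathcal{L}^2_\alpha(f)$ for limit $\gamma$ (closures in $X$). $\operatorname{Lev}^i(f)=\min\{\alpha\mid\mathcal{L}^i_\alpha(f)=\emptyset\}$,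 where a non-existing Level is treated as a value greater than all ordinals. For a problem $P$, $\operatorname{Lev}^i(P)=\min\{\operatorname{Lev}^i(f)\mid f\in P\}$ (the minimum of an empty collection being this non-existing value). *)

(* Defs.v *)
From mathcomp Require Import all_boot.
From mathcomp Require Import boolp classical_sets filter topology.

Set Implicit Arguments.
Unset Strict Implicit.
Unset Printing Implicit Defensive.

Local Open Scope classical_set_scope.

(** [OSup t] denotes the least ordinal strictly above all the [t i]; ordinals
    are such trees up to mutual [tree_le], so that equality of ordinals is
    Leibniz equality.  They are deliberately kept outside the MathComp
    hierarchy (and outside [set]): the index types [I] have to range over a
    universe that contains the carriers of all topological spaces, see
    [level_set_stationary]. *)

Inductive tree : Type := OSup (I : Type) (t : I -> tree).

Fixpoint tree_le (a b : tree) {struct a} : Prop :=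
  match a, b with
  | OSup J s, OSup K t => forall j : J, exists k : K, tree_le (s j) (t k)
  end.

Definition tree_eqv (a b : tree) : Prop := tree_le a b /\ tree_le b a.

Record ordinal_number : Type := OrdinalNumber {
  ord_class : tree -> Prop;
  ord_classP : exists t, ord_class = tree_eqv t }.

Definition ord_of (t : tree) : ordinal_number :=
  @OrdinalNumber (tree_eqv t) (ex_intro _ t erefl).

Definition ord_repr (a : ordinal_number) : tree := projT1 (cid (ord_classP a)).

Definition ord_le (a b : ordinal_number) : Prop :=
  tree_le (ord_repr a) (ord_repr b).

Definition ord_lt (a b : ordinal_number) : Prop := ord_le a b /\ a <> b.

Definition ord_ssup (I : Type) (a : I -> ordinal_number) : ordinal_number :=
  ord_of (OSup (fun i => ord_repr (a i))).

Definition ord_zero : ordinal_number :=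
  ord_ssup (fun i : Empty_set => match i with end).

Definition ord_succ (a : ordinal_number) : ordinal_number :=
  ord_ssup (fun _ : unit => a).

Definition ord_limit (a : ordinal_number) : Prop :=
  a <> ord_zero /\ forall b, a <> ord_succ b.

Lemma tree_le_refl a : tree_le a a.
Proof. by elim: a => I t IH i; exists i; exact: IH. Qed.

Lemma tree_le_trans b a c : tree_le a b -> tree_le b c -> tree_le a c.
Proof.
elim: a b c => I s IH [J t] [K u] /= st tu i.
have [j sitj] := st i; have [k tjuk] := tu j.
by exists k; exact: IH sitj tjuk.
Qed.

Lemma tree_le_total a b :
  tree_le a b \/ match a with OSup J s => exists j, tree_le b (s j) end.
Proof.
elim: a b => I s IH [J t].
have [?|] := pselect (tree_le (OSup s) (OSup t)); first by left.
move=> /existsNP[i /forallNP nst]; right; exists i.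
case E : (s i) => [K u] j; rewrite /=.
by have [/nst//|] := IH i (t j); rewrite E.
Qed.

Lemma tree_le_child I (t : I -> tree) i : tree_le (t i) (OSup t).
Proof.
suff H : forall a, match a with OSup J u => forall j, tree_le (u j) a end.
  exact: H (OSup t) i.
elim=> J u IH j; case E : (u j) => [K v] k; exists j.
by have := IH j; rewrite E; apply.
Qed.

Lemma tree_eqv_eq a b : tree_eqv a b -> tree_eqv a = tree_eqv b.
Proof.
move=> [ab ba]; apply: funext => c; apply: propext; split=> -[h k]; split.
- exact: tree_le_trans ba h.
- exact: tree_le_trans k ab.
- exact: tree_le_trans ab h.
- exact: tree_le_trans k ba.
Qed.

Lemma ord_ext a b : ord_class a = ord_class b -> a = b.
Proof.
case: a b => [A hA] [B hB] /= E; rewrite E in hA *.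
by rewrite (Prop_irrelevance hA hB).
Qed.

Lemma ord_reprK a : ord_of (ord_repr a) = a.
Proof. by apply: ord_ext; rewrite /ord_repr; case: cid => t /= ->. Qed.

Lemma ord_of_repr t : tree_eqv t (ord_repr (ord_of t)).
Proof.
rewrite /ord_repr; case: cid => u /= ->; split; exact: tree_le_refl.
Qed.

Lemma ord_le_refl a : ord_le a a.
Proof. exact: tree_le_refl. Qed.

Lemma ord_le_trans b a c : ord_le a b -> ord_le b c -> ord_le a c.
Proof. exact: tree_le_trans. Qed.

Lemma ord_le_anti a b : ord_le a b -> ord_le b a -> a = b.
Proof.
move=> ab ba; rewrite -(ord_reprK a) -(ord_reprK b).
exact/ord_ext/tree_eqv_eq.
Qed.

Lemma ord_le_total a b : ord_le a b \/ ord_le b a.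
Proof.
rewrite /ord_le; have [|] := tree_le_total (ord_repr a) (ord_repr b).
  by left.
case: (ord_repr a) => I s [i bs]; right.
exact: tree_le_trans bs (tree_le_child s i).
Qed.

Lemma ord_ltNge a b : ord_lt a b <-> ~ ord_le b a.
Proof.
split=> [[ab nab] /(ord_le_anti ab)//|nba].
by have [ab|//] := ord_le_total a b; split=> // E; apply: nba; rewrite E;
  exact: ord_le_refl.
Qed.

Lemma ord_lt_le_trans b a c : ord_lt a b -> ord_le b c -> ord_lt a c.
Proof.
by move=> /ord_ltNge ab bc; apply/ord_ltNge => ca; exact/ab/(ord_le_trans bc).
Qed.

Lemma tree_leNP I (t : I -> tree) a :
  ~ tree_le (OSup t) a <-> exists i, tree_le a (t i).
Proof.
split=> [nta|[i ati ta]]; first by have [|] := tree_le_total (OSup t) a.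
have {a ta ati} : tree_le (OSup t) (t i) by exact: tree_le_trans ta ati.
suff H : forall a, match a with OSup J u => forall j, ~ tree_le a (u j) end.
  exact: H (OSup t) i.
elim=> {t i}J u IH j; case E : (u j) (IH j) => [K v] IHj h.
by have [k] := h j; rewrite E => /IHj.
Qed.

Lemma ord_lt_ssup I (a : I -> ordinal_number) b :
  ord_lt b (ord_ssup a) <-> exists i, ord_le b (a i).
Proof.
rewrite /ord_ssup; set t := OSup _.
have [tr rt] := ord_of_repr t.
split.
  move=> /ord_ltNge ab; apply/tree_leNP => tb.
  exact/ab/(tree_le_trans rt).
move=> /tree_leNP tb; apply/ord_ltNge => ab.
exact/tb/(tree_le_trans tr).
Qed.

Lemma ord_lt_succ a b : ord_lt b (ord_succ a) <-> ord_le b a.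
Proof. by rewrite ord_lt_ssup; split=> [[]//|]; exists tt. Qed.

Lemma ord_lt_zero a : ~ ord_lt a ord_zero.
Proof. by move=> /ord_lt_ssup[[]]. Qed.

Lemma ord_succ_inj a b : ord_succ a = ord_succ b -> a = b.
Proof.
move=> E; apply: ord_le_anti; apply/ord_lt_succ.
  by rewrite -E; apply/ord_lt_succ/ord_le_refl.
by rewrite E; apply/ord_lt_succ/ord_le_refl.
Qed.

Lemma ord_lt_wf : well_founded ord_lt.
Proof.
suff H : forall t b, tree_le (ord_repr b) t -> Acc ord_lt b.
  by move=> a; exact: H (tree_le_refl _).
elim=> I t IH b bt; constructor=> c /ord_ltNge cb.
have [i cti] : exists i, tree_le (ord_repr c) (t i).
  by apply/tree_leNP => tc; apply: cb; exact: tree_le_trans bt tc.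
exact: IH cti.
Qed.

(** [None] is a value greater than all ordinals; the minimum of an empty
    collection is [None]. *)

Definition eord_le (a b : option ordinal_number) : Prop :=
  match a, b with
  | _, None => True
  | None, Some _ => False
  | Some a, Some b => ord_le a b
  end.

Definition is_eord_min (S : option ordinal_number -> Prop)
    (m : option ordinal_number) : Prop :=
  S m /\ forall s, S s -> eord_le m s.

Definition eord_min (S : option ordinal_number -> Prop) :
    option ordinal_number :=
  if pselect (exists m, is_eord_min S m) is left h then projT1 (cid h)
  else None.

Lemma eord_minP S : (exists s, S s) -> is_eord_min S (eord_min S).
Proof.
move=> [s0 Ss0]; rewrite /eord_min; case: pselect => [h|]; first by case: cid.
case; have [[a Sa]|nS] := pselect (exists a, S (Some a)); last first.
  case: s0 Ss0 => [a Sa|SN]; first by case: nS; exists a.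
  by exists None; split=> // -[a Sa|//]; case: nS; exists a.
elim/(well_founded_ind ord_lt_wf): a Sa => a IH Sa.
have [[b [ba Sb]]|nb] := pselect (exists b, ord_lt b a /\ S (Some b)).
  exact: IH ba Sb.
exists (Some a); split=> // -[b Sb|//] /=.
apply: contrapT => nab; apply: nb; exists b; split=> //; exact/ord_ltNge.
Qed.

Definition pfun (X Y : Type) : Type := X -> option Y.

Definition dom (X Y : Type) (f : pfun X Y) : set X :=
  [set x | exists y, f x = Some y].

(** For [x] in [A `<=` dom f]: the restriction of [f] to the subspace [A] is
    continuous at [x]. *)
Definition continuous_at_in (X Y : topologicalType) (f : pfun X Y)
    (A : set X) (x : X) : Prop :=
  forall y, f x = Some y -> forall V : set Y, nbhs y V ->
    \forall z \near within A (nbhs x), exists2 w, f z = Some w & V w.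

Definition pcontinuous (X Y : topologicalType) (f : pfun X Y) : Prop :=
  forall x, dom f x -> continuous_at_in f (dom f) x.

Definition problem (X Y : topologicalType) : Type := set (pfun X Y).

(** [x |-> F (x, g (G x))], defined wherever all of its constituents are. *)
Definition reduction_comp (X1 Y1 X2 Y2 : Type) (F : pfun (X1 * Y2) Y1)
    (G : pfun X1 X2) (g : pfun X2 Y2) : pfun X1 Y1 :=
  fun x => obind (fun u => obind (fun v => F (x, v)) (g u)) (G x).

Definition reducible2 (X1 Y1 X2 Y2 : topologicalType)
    (P : problem X1 Y1) (Q : problem X2 Y2) : Prop :=
  exists (F : pfun (X1 * Y2)%type Y1) (G : pfun X1 X2),
    [/\ pcontinuous F, pcontinuous G
      & forall g, Q g -> P (reduction_comp F G g)].

Variant level_index : Type := level1 | level2.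

Section Level.
Variables (i : level_index) (X Y : topologicalType) (f : pfun X Y).

Definition discontinuity_set (A : set X) : set X :=
  [set x | A x /\ ~ continuous_at_in f A x].

(** A partial function is a function on its domain, so the closure is taken in
    the subspace [dom f]. *)
Definition level_closure (A : set X) : set X :=
  match i with level1 => A | level2 => closure A `&` dom f end.

Definition level_set_body (a : ordinal_number)
    (L : forall b, ord_lt b a -> set X) : set X :=
  if pselect (a = ord_zero) then dom f
  else if pselect (exists b, a = ord_succ b) then
    level_closure [set x | exists b (ba : ord_lt b a),
                             a = ord_succ b /\ discontinuity_set (L b ba) x]
  else level_closure [set x | forall b (ba : ord_lt b a), L b ba x].

Definition level_set : ordinal_number -> set X :=
  Fix ord_lt_wf (fun=> set X) level_set_body.

Lemma level_setE a :
  level_set a = level_set_body (fun b (_ : ord_lt b a) => level_set b).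
Proof.
rewrite /level_set Fix_eq // => {}a g h gh; congr level_set_body.
by apply: functional_extensionality_dep => b;
  apply: functional_extensionality_dep => ba; exact: gh.
Qed.

Lemma level_set_zero : level_set ord_zero = dom f.
Proof. by rewrite level_setE /level_set_body; case: pselect. Qed.

Lemma level_set_succ a :
  level_set (ord_succ a) = level_closure (discontinuity_set (level_set a)).
Proof.
have aSa : ord_lt a (ord_succ a) by apply/ord_lt_succ/ord_le_refl.
rewrite level_setE /level_set_body; case: pselect => [E|? /=].
  by rewrite E in aSa; case: (ord_lt_zero aSa).
case: pselect => [? /=|[]]; last by exists a.
congr level_closure; apply/seteqP; split=> x.
  by move=> [b [ba [E]]]; rewrite (ord_succ_inj E).
by move=> Dx; exists a, aSa.
Qed.

Lemma level_set_limit a : ord_limit a ->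
  level_set a = level_closure [set x | forall b, ord_lt b a -> level_set b x].
Proof.
move=> [a0 aS]; rewrite level_setE /level_set_body.
by case: pselect => // ? /=; case: pselect => // -[b ab]; case: (aS b).
Qed.

Lemma level_closureS A B :
  A `<=` B -> level_closure A `<=` level_closure B.
Proof.
rewrite /level_closure; case: i => // AB x [Ax fx]; split=> //.
exact: closure_subset Ax.
Qed.

Lemma level_closureK A :
  level_closure (level_closure A) `<=` level_closure A.
Proof.
rewrite /level_closure; case: i => // x [Ax fx]; split=> //.
have := closure_subset (@subIsetl _ (closure A) (dom f)) Ax.
by rewrite -(closure_id (closure A)).1//; exact: closed_closure.
Qed.

Lemma level_set_closed a : level_closure (level_set a) `<=` level_set a.
Proof.
have [->|a0] := pselect (a = ord_zero).
  by rewrite level_set_zero /level_closure; case: i => // x [].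
have [[b ->]|aS] := pselect (exists b, a = ord_succ b).
  by rewrite level_set_succ; exact: level_closureK.
rewrite level_set_limit; first exact: level_closureK.
by split=> // b E; apply: aS; exists b.
Qed.

Lemma level_set_anti a b : ord_le a b -> level_set b `<=` level_set a.
Proof.
elim/(well_founded_ind ord_lt_wf): b a => b IH a ab.
have [->//|nab] := pselect (a = b).
have {}ab : ord_lt a b by [].
have [b0|b0] := pselect (b = ord_zero).
  by rewrite b0 in ab; case: (ord_lt_zero ab).
have [[c bc]|bS] := pselect (exists c, b = ord_succ c).
  rewrite bc in ab IH *; rewrite level_set_succ.
  move/ord_lt_succ: ab => ac; apply: subset_trans (IH c _ a ac); last first.
    exact/ord_lt_succ/ord_le_refl.
  by apply: subset_trans (@level_set_closed c); apply: level_closureS => x [].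
rewrite level_set_limit; last by split=> // c E; apply: bS; exists c.
apply: subset_trans (@level_set_closed a); apply: level_closureS => x.
exact.
Qed.

Definition Lev : option ordinal_number :=
  eord_min (fun m => exists2 a, m = Some a & level_set a = set0).

End Level.

Definition Lev_problem (i : level_index) (X Y : topologicalType)
    (P : problem X Y) : option ordinal_number :=
  eord_min (fun m => exists2 f, P f & m = Lev i f).

(** There are enough ordinals for the level sets of every [f] to become
    stationary, so [Lev i f = None] exactly when they stabilize at a nonempty
    set. *)
Lemma level_set_stationary (i : level_index) (X Y : topologicalType)
    (f : pfun X Y) :
  exists a, forall b, ord_le a b -> level_set i f b = level_set i f a.
Proof.
pose c (A : set X) : ordinal_number :=
  if pselect (exists b, level_set i f b = A) is left h then projT1 (cid h)
  else ord_zero.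
have cP b : level_set i f (c (level_set i f b)) = level_set i f b.
  by rewrite /c; case: pselect => [h|[]]; [case: cid | exists b].
exists (ord_ssup c) => b ab; apply/seteqP; split.
  exact: level_set_anti.
rewrite -(cP b); apply: level_set_anti.
have [] // : ord_lt (c (level_set i f b)) (ord_ssup c).
by apply/ord_lt_ssup; exists (level_set i f b); exact: ord_le_refl.
Qed.

(* Main.v *)
Require Import Defs.
From mathcomp Require Import all_boot.
From mathcomp Require Import boolp classical_sets filter topology.

(** For [g] in [Q] put [h x := F (x, g (G x))], an element of [P].  By
    transfinite induction, [G] maps the level sets of [h] into those of [g]:
    where [g] restricted to a level set is continuous, so is [h], and the
    continuity of [G] carries closures along.  Hence a level set of [h] is
    empty as soon as the corresponding one of [g] is. *)

Local Open Scope classical_set_scope.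

(** Membership includes definedness of [G] at the point, so an inclusion in [ppreimage G B] also
    yields a value of [G]. *)
Definition ppreimage {X Y : Type} (G : pfun X Y) (B : set Y) : set X :=
  [set x | exists2 u, G x = Some u & B u].

Lemma level_set_dom i (X Y : topologicalType) (f : pfun X Y) a :
  level_set i f a `<=` dom f.
Proof.
rewrite -(level_set_zero i f); apply: level_set_anti; apply: contrapT.
by move=> /ord_ltNge; exact: ord_lt_zero.
Qed.

Section ReductionLevels.
Context {X1 Y1 X2 Y2 : topologicalType} {F : pfun (X1 * Y2)%type Y1}
  {G : pfun X1 X2} (g : pfun X2 Y2).
Hypotheses (cF : pcontinuous F) (cG : pcontinuous G).
Let h := reduction_comp F G g.

Lemma reduction_compP x y : h x = Some y ->
  exists u v, [/\ G x = Some u, g u = Some v & F (x, v) = Some y].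
Proof.
rewrite /h /reduction_comp; case: (G x) => //= u; case E : (g u) => //= [v] Fv.
by exists u, v.
Qed.

Lemma dom_reduction_comp : dom h `<=` ppreimage G (dom g).
Proof.
by move=> x [y /reduction_compP[u [v [Gx gu _]]]]; exists u => //; exists v.
Qed.

(** Continuity of [F] at [(x, v)] provides a box [U1], [U2]; continuity of [g] within [B], pulled
    back along [G], keeps [g (G z)] in [U2] for [z] in [A] near [x]. As [A] lies in [dom h], the
    pair [(z, g (G z))] lies in [dom F]. *)
Lemma reduction_comp_continuous_at (A : set X1) (B : set X2) x u :
  A `<=` dom h -> A `<=` ppreimage G B -> G x = Some u ->
  continuous_at_in g B u -> continuous_at_in h A x.
Proof.
move=> Ah AB Gx cg y /reduction_compP[u' [v []]].
rewrite Gx => -[<-] gu Fxv V Vy.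
have domF : dom F (x, v) by exists y.
have [[U1 U2] /= [U1x U2v] FV] := cF _ domF _ Fxv _ Vy.
have domG : dom G x by exists u.
(* The neighbourhood of [u] fed to [cG] consists of the points that, if in [B], are sent by [g] into
   [U2]. *)
have nearG := cG _ domG _ Gx _ (cg _ gu _ U2v).
rewrite near_withinE; near=> z => Az.
have [y' /[dup] hz /reduction_compP[u1 [w [Gz gw Fw]]]] := Ah _ Az.
have [u2] := AB _ Az; rewrite Gz => -[<-] Bu1.
have U1z : U1 z by near: z.
have domGz : dom G z by exists u1.
have [u3] : exists2 u', G z = Some u' &
    B u' -> exists2 w, g u' = Some w & U2 w.
  by move: domGz; near: z; exact: nearG.
rewrite Gz => -[<-] /(_ Bu1)[w']; rewrite gw => -[<-] U2w.
have domFz : dom F (z, w) by exists y'.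
have [y2] := FV (z, w) (conj U1z U2w) domFz.
by rewrite Fw => -[<-] Vy'; exists y'.
Unshelve. all: by end_near. Qed.

Lemma ppreimage_discontinuity_set (A : set X1) (B : set X2) :
  A `<=` dom h -> A `<=` ppreimage G B ->
  discontinuity_set h A `<=` ppreimage G (discontinuity_set g B).
Proof.
move=> Ah AB x [Ax ncx]; have [u Gx Bu] := AB _ Ax.
exists u => //; split=> // cg; apply: ncx.
exact: reduction_comp_continuous_at Gx cg.
Qed.

(** For [level2], the closure is cut down to [dom h], so [G] is defined at the limit point with
    value in [dom g]; a neighbourhood of that value pulls back along [G] to one that meets [A]. *)
Lemma ppreimage_level_closure i (A : set X1) (B : set X2) :
  A `<=` ppreimage G B ->
  level_closure i h A `<=` ppreimage G (level_closure i g B).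
Proof.
case: i => //= AB x [clA /dom_reduction_comp[u Gx gu]].
exists u => //; split=> // V Vu.
have domG : dom G x by exists u.
have [z [/AB[u' Gz Bu']]] := clA _ (cG _ domG _ Gx _ Vu).
have domGz : dom G z by exists u'.
by move=> /(_ domGz)[u'']; rewrite Gz => -[<-] Vu'; exists u'.
Qed.

Lemma ppreimage_level_set i a :
  level_set i h a `<=` ppreimage G (level_set i g a).
Proof.
elim/(well_founded_ind ord_lt_wf): a => a IH.
have [->|a0] := pselect (a = ord_zero).
  by rewrite !level_set_zero; exact: dom_reduction_comp.
have [[b ab]|aS] := pselect (exists b, a = ord_succ b).
  rewrite ab !level_set_succ; apply: ppreimage_level_closure.
  apply: ppreimage_discontinuity_set; first exact: level_set_dom.
  by apply: IH; rewrite ab; exact/ord_lt_succ/ord_le_refl.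
have lim_a : ord_limit a by split=> // b E; apply: aS; exists b.
have lt0a : ord_lt ord_zero a.
  apply/ord_ltNge => a_le0; apply: a0; apply: ord_le_anti => //.
  by apply: contrapT => /ord_ltNge; exact: ord_lt_zero.
rewrite !level_set_limit//; apply: ppreimage_level_closure => x Lx.
(* Level zero fixes one value [u] of [G x]; since [G] is single-valued, every lower level of [g]
   contains this same [u]. *)
have [u Gx _] := IH _ lt0a _ (Lx _ lt0a).
exists u => // b ba; have [u'] := IH _ ba _ (Lx _ ba).
by rewrite Gx => -[<-].
Qed.

Lemma Lev_reduction_comp i : eord_le (Lev i h) (Lev i g).
Proof.
(* If there is no minimum, [Lev i g] is [None], which bounds everything; otherwise it is attained at
   some [a] with empty level set. *)
rewrite {2}/Lev /eord_min; case: pselect => [m|_]; last by case: (Lev i h).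
case: cid => /= _ [[a -> ga0] _].
suff ha0 : level_set i h a = set0.
  have [|_] := @eord_minP
    (fun m => exists2 a, m = Some a & level_set i h a = set0).
    by exists (Some a), a.
  by apply; exists a.
apply/seteqP; split=> // x /ppreimage_level_set[u _].
by rewrite ga0.
Qed.

End ReductionLevels.

Lemma eord_le_trans b a c : eord_le a b -> eord_le b c -> eord_le a c.
Proof. case: a b c => [a|] [b|] [c|] //=; exact: ord_le_trans. Qed.

Theorem theorem5p7 (i : level_index) (X1 Y1 X2 Y2 : topologicalType)
    (P : problem X1 Y1) (Q : problem X2 Y2) (hPQ : reducible2 P Q) :
  eord_le (Lev_problem i P) (Lev_problem i Q).
Proof.
have [F [G [cF cG PFG]]] := hPQ.
(* The default [None], taken for instance when [Q] is empty, is again trivial; otherwise some [g] in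
   [Q] attains the minimum. *)
rewrite {2}/Lev_problem /eord_min; case: pselect => [m|_]; last first.
  by case: (Lev_problem i P).
case: cid => /= _ [[g Qg ->] _].
apply: eord_le_trans (Lev_reduction_comp g cF cG i).
have [|_] := @eord_minP (fun m => exists2 f, P f & m = Lev i f).
  exists (Lev i (reduction_comp F G g)), (reduction_comp F G g) => //.
  exact: PFG.
by apply; exists (reduction_comp F G g) => //; exact: PFG.
Qed.
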